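(* For a parameter $t$ set $$\varphi_{11}(x)=-\frac{(2t^2+3t+3)(3t+1)^2}{108}\cdot\frac{F_{11}(x)^3\,G_{11}(x)}{H_{11}(x)^5},$$ where $$\begin{aligned}F_{11}={}&x^3-\frac{4941t^6+13122t^5+19905t^4+17820t^3+10795t^2+3962t+879}{(3t+1)^2(2t^2+3t+3)}x^2\\&+\frac{(3t+1)(432t^5+570t^4+330t^3-265t^2-340t-151)}{2t^2+3t+3}x+3(2t^2+3t+3)(3t+1)^4,\end{aligned}$$ $$\begin{aligned}G_{11}={}&(3t^2+2t+2)^2x^2\\&+\frac{27t^{10}+270t^9+945t^8+2160t^7+2745t^6+1926t^5-5t^4-1340t^3-1440t^2-720t-216}{(2t^2+3t+3)(3t+1)^2}x\\&-4(3t+1)(2t^2+3t+3),\end{aligned}$$ $$H_{11}=(5t^2+4t+3)x^2+\frac{135t^6+396t^5+715t^4+790t^3+610t^2+280t+82}{2t^2+3t+3}x+(2t^2+3t+3)(3t+1)^3.$$ Then there is a polynomial $P_{11}$ in $x$ of degree $5$ (with coefficients in $\mathbb{Q}(t)$ and leading coefficient $(3t^2+2t+2)(2t^2+3t+3)(3t+1)$) such that $$1-\varphi_{11}(x)=\frac{1}{108(2t^2+3t+3)}\cdot\frac{x\,P_{11}(x)^2}{H_{11}(x)^5}.$$ Moreover, for generic $t$ (all but finitely many $t\in\mathbb{C}$), $\varphi_{11}:\mathbb{P}^1_x\to\mathbb{P}^1_z$ is an almost Belyi covering of degree $11$ with ramification pattern $$R_4\big(3+3+3+1+1\,|\,2+2+2+2+2+1\,|\,5+5+1\big),$$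 the non-ramified point above $z=\infty$ being $x=\infty$, the non-ramified point above $z=1$ being $x=0$, and the extra ramification point being $$x=\frac{3t^5+15t^4+15t^3+45t^2+40t+26}{(3t^2+2t+2)(5t^2+4t+3)}.$$
   Context: An almost Belyi covering is a rational map $\varphi:\mathbb{P}^1_x\to\mathbb{P}^1_z$ such that all its ramified points, except exactly one simply ramified point (ramification order $2$), lie above $\{0,1,\infty\}\subset\mathbb{P}^1_z$; the exceptional point lies above a fourth point of $\mathbb{P}^1_z\setminus\{0,1,\infty\}$ and is called the extra ramification point. For partitions $P_1,P_2,P_3$ of $n$, an almost Belyi covering of degree $n$ has ramification pattern $R_4(P_1\,|\,P_2\,|\,P_3)$ if the ramification orders of the points above $z=0$, $z=1$, $z=\infty$ are given, respectively, by $P_1,P_2,P_3$ (the fourth ramified fiber then has pattern $2+1+\cdots+1$). *)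

(* Defs.v *)
From HB Require Import structures.
From mathcomp Require Import all_boot all_order all_algebra.
From mathcomp Require Import reals complex.

Set Implicit Arguments.
Unset Strict Implicit.
Unset Printing Implicit Defensive.

Import GRing.Theory.
Local Open Scope ring_scope.

Notation "x %:F" := (@FracField.tofrac _ x) : ring_scope.

(* None is the point at infinity. *)
Definition P1 (K : fieldType) := option K.

Section RationalMaps.
Variable K : fieldType.
Implicit Types (f : {fraction {poly K}}) (x z : P1 K).

Definition cst (c : K) : {fraction {poly K}} := (c%:P)%:F.

(* Coprime numerator and denominator, determined up to a common nonzero
   constant factor; what is built on them below does not depend on it. *)
Definition rnum f : {poly K} :=
  let r := repr f in \n_r %/ gcdp \n_r \d_r.
Definition rden f : {poly K} :=
  let r := repr f in \d_r %/ gcdp \n_r \d_r.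

Definition rdeg f : nat := (maxn (size (rnum f)) (size (rden f))).-1.

(* At infinity, the coefficients in degree rdeg f are the values at [1 : 0] of
   the homogenizations of the numerator and of the denominator. *)
Definition rmap f x : P1 K :=
  let: (a, b) := if x is Some u then ((rnum f).[u], (rden f).[u])
                 else ((rnum f)`_(rdeg f), (rden f)`_(rdeg f)) in
  if b == 0 then None else Some (a / b).

(* Order of vanishing of f at x, negative at a pole; junk for f = 0. *)
Definition rord f x : int :=
  if x is Some u then (mup u (rnum f))%:Z - (mup u (rden f))%:Z
  else (size (rden f))%:Z - (size (rnum f))%:Z.

(* Ramification order at x: the order at x of the pullback of a local
   parameter at rmap f x; meaningful for nonconstant f only. *)
Definition ramord f x : nat :=
  if rmap f x is Some c then `|rord (f - cst c)%R x|%N else `|rord f x|%N.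

Definition ramified f x : Prop := (1 < ramord f x)%N.

Definition belyi_points : seq (P1 K) := [:: Some 0; Some 1; None].

Definition extra_ram_point f x : Prop :=
  [/\ ramord f x = 2%N, rmap f x \notin belyi_points &
      forall y, ramified f y -> y <> x -> rmap f y \in belyi_points].

Definition almost_belyi f : Prop :=
  (0 < rdeg f)%N /\ exists x, extra_ram_point f x.

Definition is_partition (n : nat) (p : seq nat) : bool :=
  (0%N \notin p) && (sumn p == n).

Definition fiber_pattern f z (p : seq nat) : Prop :=
  exists s : seq (P1 K),
    [/\ uniq s, forall x, x \in s <-> rmap f x = z & perm_eq (map (ramord f) s) p].

Definition R4_pattern (n : nat) (p1 p2 p3 : seq nat) f : Prop :=
  [/\ [&& is_partition n p1, is_partition n p2 & is_partition n p3],
      almost_belyi f, rdeg f = n &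
      [/\ fiber_pattern f (Some 0) p1, fiber_pattern f (Some 1) p2 &
          fiber_pattern f None p3]].

End RationalMaps.

Section Family.
Variables (K : fieldType) (t : K).

Definition F11 : {poly K} :=
  'X^3
  - ((4941 * t ^+ 6 + 13122 * t ^+ 5 + 19905 * t ^+ 4 + 17820 * t ^+ 3
      + 10795 * t ^+ 2 + 3962 * t + 879)
     / ((3 * t + 1) ^+ 2 * (2 * t ^+ 2 + 3 * t + 3))) *: 'X^2
  + ((3 * t + 1) * (432 * t ^+ 5 + 570 * t ^+ 4 + 330 * t ^+ 3
      - 265 * t ^+ 2 - 340 * t - 151)
     / (2 * t ^+ 2 + 3 * t + 3)) *: 'X
  + (3 * (2 * t ^+ 2 + 3 * t + 3) * (3 * t + 1) ^+ 4)%:P.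

Definition G11 : {poly K} :=
  (3 * t ^+ 2 + 2 * t + 2) ^+ 2 *: 'X^2
  + ((27 * t ^+ 10 + 270 * t ^+ 9 + 945 * t ^+ 8 + 2160 * t ^+ 7
      + 2745 * t ^+ 6 + 1926 * t ^+ 5 - 5 * t ^+ 4 - 1340 * t ^+ 3
      - 1440 * t ^+ 2 - 720 * t - 216)
     / ((2 * t ^+ 2 + 3 * t + 3) * (3 * t + 1) ^+ 2)) *: 'X
  - (4 * (3 * t + 1) * (2 * t ^+ 2 + 3 * t + 3))%:P.

Definition H11 : {poly K} :=
  (5 * t ^+ 2 + 4 * t + 3) *: 'X^2
  + ((135 * t ^+ 6 + 396 * t ^+ 5 + 715 * t ^+ 4 + 790 * t ^+ 3
      + 610 * t ^+ 2 + 280 * t + 82)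
     / (2 * t ^+ 2 + 3 * t + 3)) *: 'X
  + ((2 * t ^+ 2 + 3 * t + 3) * (3 * t + 1) ^+ 3)%:P.

Definition phi11 : {fraction {poly K}} :=
  - cst ((2 * t ^+ 2 + 3 * t + 3) * (3 * t + 1) ^+ 2 / 108)
  * ((F11 ^+ 3 * G11)%:F / (H11 ^+ 5)%:F).

Definition extra11 : K :=
  (3 * t ^+ 5 + 15 * t ^+ 4 + 15 * t ^+ 3 + 45 * t ^+ 2 + 40 * t + 26)
  / ((3 * t ^+ 2 + 2 * t + 2) * (5 * t ^+ 2 + 4 * t + 3)).

End Family.

(* The field Q(t) and its indeterminate. *)
Notation Qt := {fraction {poly rat}}.
Definition tQ : Qt := ('X)%:F.

(* Main.v *)
Require Import Defs.
From mathcomp Require Import all_boot all_order all_algebra.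
From mathcomp Require Import reals complex.
From mathcomp Require Import ring zify.

Set Implicit Arguments.
Unset Strict Implicit.
Unset Printing Implicit Defensive.

Import GRing.Theory Num.Theory.
Local Open Scope ring_scope.

(** Clear denominators in the coefficients: F, G, H are the integral multiples
of F11, G11, H11, and P is an explicit quintic in x over Z[t].  Write A = 3t+1,
B = 2t^2+3t+3, C = 3t^2+2t+2, D = 5t^2+4t+3, E for the numerator of the extra
point e, so that e = E/(CD), and phi11 = n/d with n = -B^2 F^3 G and
d = 108 A^6 H^5.  Everything rests on two polynomial identities in Z[t][x]:
- d - n = x P^2 ([complement_identity]), which is the first claim up to a
  constant factor of P;
- 3F'GH + FG'H - 5FGH' = P (CD x - E) ([wronskian_identity]), which says that
  the Wronskian n'd - nd' is a constant times F^2 H^4 P (x - e).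

In characteristic 0 the ramification order of a reduced fraction n/d at a
finite point u is one more than the multiplicity of u in the Wronskian
([ramord_wronskian]).  So every finite ramified point is e or a root of F, H
or P.  Comparison with the multiplicity of u in n, in d - n or in d also shows
that the roots are simple.  With f, g, h, p the multiplicities of u in F, G, H,
P: over 0, 3f + g = 2f + 1 forces f + g = 1; over 1, [u = 0] + 2p = p + 1
forces [u = 0] + p = 1; over infinity, 5h = 4h + 1 forces h = 1.

These comparisons use that n and d are coprime and that e lies above none of
0, 1, infinity.  Coprimality comes from the resultants of F and H and of G and
H, which factor completely into small polynomials in t.  The position of e
comes from the values of F, G, H, P at e.  The product of the corresponding
polynomials in t, [degeneracy], is nonzero since it does not vanish at t = 0;
its roots are the exceptional parameters. *)

(** * Reduced fractions over a field *)

Lemma frac_reprE (R : idomainType) (f : {fraction R}) :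
  f = (\n_(repr f))%:F / (\d_(repr f))%:F.
Proof.
have dN0 : (\d_(repr f))%:F != 0 :> {fraction R}.
  by rewrite tofrac_eq0 denom_ratioP.
apply: (mulIf dN0); rewrite divfK // -[X in X * _]reprK; unlock FracField.tofrac.
rewrite -[LHS]FracField.pi_mul; apply/eqmodP.
rewrite /= FracField.equivfE /FracField.mulf.
rewrite !numden_Ratio ?mulr1 ?oner_eq0 ?denom_ratioP //.
by rewrite mulrC.
Qed.

Section ReducedFractions.
Variable K : fieldType.
Implicit Types (f : {fraction {poly K}}) (n d p q : {poly K}) (u c : K).

Lemma rden_neq0 f : rden f != 0.
Proof.
rewrite /rden; set r := repr f.
have dN0 : \d_r != 0 by apply: denom_ratioP.
by rewrite dvdp_div_eq0 ?dvdp_gcdr.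
Qed.

Lemma coprime_rnum_rden f : coprimep (rnum f) (rden f).
Proof.
by rewrite /rnum /rden coprimep_div_gcd // denom_ratioP orbT.
Qed.

Lemma rnum_rdenE f : f = (rnum f)%:F / (rden f)%:F.
Proof.
rewrite {1}(frac_reprE f) /rnum /rden; set r := repr f.
have dN0 : \d_r != 0 by apply: denom_ratioP.
set g := gcdp \n_r \d_r; have gN0 : g != 0 by rewrite gcdp_eq0 (negPf dN0) andbF.
have {1}-> : \n_r = \n_r %/ g * g by rewrite divpK // dvdp_gcdl.
have {1}-> : \d_r = \d_r %/ g * g by rewrite divpK // dvdp_gcdr.
by rewrite !tofracM -mulf_div [g%:F / _]divff ?mulr1 // tofrac_eq0.
Qed.

(** Two coprime representations of one fraction divide each other, by Gauss,
hence are proportional.  Order, value and degree of a fraction can thus be read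
on any coprime representation. *)
Lemma rnum_rden_coprime n d : d != 0 -> coprimep n d ->
  exists2 c, c != 0 & rnum (n%:F / d%:F) = c *: n /\ rden (n%:F / d%:F) = c *: d.
Proof.
move=> dN0 co_nd; set f := n%:F / d%:F.
have cross : rnum f * d = n * rden f.
  apply/eqP; rewrite -tofrac_eq !tofracM -eqr_div ?tofrac_eq0 ?rden_neq0 //.
  by rewrite -rnum_rdenE.
have /eqpP[[a b] /= /andP[aN0 bN0] abE] : rden f %= d.
  apply/andP; split.
    rewrite -(Gauss_dvdpr _ (q := rnum f)) 1?coprimep_sym ?coprime_rnum_rden //.
    by rewrite cross dvdp_mull.
  by rewrite -(Gauss_dvdpr _ (q := n)) 1?coprimep_sym // -cross dvdp_mull.
have rdE : rden f = (b / a) *: d.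
  by rewrite mulrC -scalerA -abE scalerA mulVf // scale1r.
exists (b / a); first by rewrite mulf_neq0 ?invr_eq0.
by split=> //; apply: (mulIf dN0); rewrite cross rdE -scalerAr -scalerAl.
Qed.

Lemma mupZ c u p : c != 0 -> mup u (c *: p) = mup u p.
Proof.
by move=> cN0; rewrite -mul_polyC mupMr // rootC.
Qed.

Section Reduced.
Variables n d : {poly K}.
Hypotheses (dN0 : d != 0) (co_nd : coprimep n d).
Let f := n%:F / d%:F.

Lemma rdeg_reduced : rdeg f = (maxn (size n) (size d)).-1.
Proof.
have [c cN0 [nE dE]] := rnum_rden_coprime dN0 co_nd.
by rewrite /rdeg /f nE dE !size_scale.
Qed.

Lemma rmap_reduced u :
  rmap f (Some u) = if d.[u] == 0 then None else Some (n.[u] / d.[u]).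
Proof.
have [c cN0 [nE dE]] := rnum_rden_coprime dN0 co_nd.
rewrite /rmap /f nE dE !hornerZ mulf_eq0 (negPf cN0) /=.
by case: eqP => // /eqP duN0; rewrite -mulf_div divff // mul1r.
Qed.

Lemma rord_reduced u : rord f (Some u) = (mup u n)%:Z - (mup u d)%:Z.
Proof.
have [c cN0 [nE dE]] := rnum_rden_coprime dN0 co_nd.
by rewrite /rord /f nE dE !mupZ.
Qed.

Hypothesis lt_dn : (size d < size n)%N.

Lemma rmap_reduced_infty : rmap f None = None.
Proof.
have [c cN0 [nE dE]] := rnum_rden_coprime dN0 co_nd.
rewrite /rmap rdeg_reduced /f nE dE !coefZ (maxn_idPl (ltnW lt_dn)).
rewrite [d`_ _]nth_default ?mulr0 ?eqxx //.
by case: (size n) lt_dn.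
Qed.

Lemma ramord_reduced_infty : ramord f None = (size n - size d)%N.
Proof.
have [c cN0 [nE dE]] := rnum_rden_coprime dN0 co_nd.
rewrite /ramord rmap_reduced_infty /rord /f nE dE !size_scale //.
by rewrite distnEr // ltnW.
Qed.

End Reduced.

Lemma ramord_reduced_pole n d u : d != 0 -> coprimep n d -> root d u ->
  ramord (n%:F / d%:F) (Some u) = mup u d.
Proof.
move=> dN0 co_nd du; rewrite /ramord rmap_reduced // (eqP du) eqxx rord_reduced //.
by rewrite mupNroot ?sub0r ?abszN //; apply: contraTN du; apply: coprimep_root.
Qed.

Lemma ramord_reduced_regular n d u : d != 0 -> coprimep n d -> ~~ root d u ->
  ramord (n%:F / d%:F) (Some u) = mup u (n - (n.[u] / d.[u]) *: d).
Proof.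
move=> dN0 co_nd du; rewrite /ramord rmap_reduced // -[_ == 0]/(root d u) (negPf du).
set c := n.[u] / d.[u].
have -> : n%:F / d%:F - cst c = (n - c *: d)%:F / d%:F.
  by rewrite tofracB -mul_polyC tofracM mulrBl mulfK // tofrac_eq0.
rewrite rord_reduced //; first by rewrite (mupNroot du) subr0.
by rewrite coprimep_sym addrC -mul_polyC -mulNr -polyCN coprimep_addl_mul coprimep_sym.
Qed.

(** * Ramification order and Wronskian *)

Hypothesis char0 : forall m, (m.+1%:R : K) != 0.

(** The Wronskian does not change when the fraction is translated by a
constant, so that any fiber can be moved to 0. *)
Lemma wronskian_shift c n d :
  (n - c *: d)^`() * d - (n - c *: d) * d^`() = n^`() * d - n * d^`().
Proof. rewrite !derivE -!mul_polyC; ring. Qed.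

(** If n = r (X - u)^(m+1) with r(u) nonzero, the Wronskian is (X - u)^m times a
cofactor with value (m+1) r(u) d(u) at u, nonzero in characteristic 0. *)
Lemma mup_wronskian n d u : root n u -> ~~ root d u ->
  n^`() * d - n * d^`() != 0 -> mup u n = (mup u (n^`() * d - n * d^`())).+1.
Proof.
move=> nu du WN0.
have nN0 : n != 0 by apply: contraNneq WN0 => ->; rewrite deriv0 !mul0r subrr.
have [m [r]] := multiplicity_XsubC n u; rewrite nN0 /= => ru nE.
case: m => [|m] in nE.
  by move: nu; rewrite nE expr0 mulr1 (negPf ru).
have mup_pow k (q : {poly K}) : ~~ root q u -> mup u (q * ('X - u%:P) ^+ k) = k.
  by move=> qu; rewrite mupMr // mup_XsubCX eqxx.
rewrite {1}nE mup_pow //; congr _.+1; symmetry.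
have -> : n^`() * d - n * d^`() = (r * d *+ m.+1
    + (r^`() * d - r * d^`()) * ('X - u%:P)) * ('X - u%:P) ^+ m.
  rewrite nE derivM deriv_exp derivXsubC mul1r /= exprS; ring.
rewrite mup_pow // /root !hornerE subrr mulr0 addr0 hornerMn hornerM.
by rewrite -mulr_natr !mulf_neq0.
Qed.

(** At a regular point, translate the value to 0; at a pole, exchange numerator
and denominator, which only changes the sign of the Wronskian. *)
Lemma ramord_wronskian n d u : coprimep n d -> n^`() * d - n * d^`() != 0 ->
  ramord (n%:F / d%:F) (Some u) = (mup u (n^`() * d - n * d^`())).+1.
Proof.
move=> co_nd WN0.
have dN0 : d != 0 by apply: contraNneq WN0 => ->; rewrite deriv0 !mulr0 subrr.
have [du|du] := boolP (root d u).
  have nu : ~~ root n u by apply: contraTN du; apply: coprimep_root.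
  have WE : d^`() * n - d * n^`() = - (n^`() * d - n * d^`()) by ring.
  rewrite ramord_reduced_pole // (@mup_wronskian d n) // WE ?oppr_eq0 //.
  by rewrite -scaleN1r mupZ // oppr_eq0 oner_eq0.
rewrite ramord_reduced_regular //; set c := n.[u] / d.[u].
rewrite -(wronskian_shift c) in WN0 *; apply: mup_wronskian => //.
by rewrite /root !hornerE /c divfK // subrr.
Qed.

End ReducedFractions.

Lemma simple_roots (K : closedFieldType) (p : {poly K}) :
    p != 0 -> (forall u, root p u -> mup u p = 1%N) ->
  exists s, [/\ uniq s, size s = (size p).-1 & forall u, (u \in s) = root p u].
Proof.
move=> pN0 simple; have [s pE] := closed_field_poly_normal p.
have lcN0 : lead_coef p != 0 by rewrite lead_coef_eq0.
have rootE u : (u \in s) = root p u by rewrite pE rootZ // root_prod_XsubC.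
exists s; split=> //; last by rewrite {1}pE size_scale // size_prod_XsubC.
apply/count_mem_uniq => u; have [us|us] := boolP (u \in s); last first.
  exact/count_memPn.
by rewrite -mu_prod_XsubC -(mupZ _ _ lcN0) -pE simple // -rootE.
Qed.

(** * The family over Z[t] and its polynomial identities *)

(** The ring of coefficients is arbitrary: the family is needed over the
fields of the theorem and also over polynomials in t, where [degeneracy] is the
polynomial whose roots are excluded. *)
Section IntegralModel.
Variable S : comNzRingType.
Implicit Types t u : S.
(* Large coefficients are written in base 1000: a numeral denotes an iterated
   sum of ones, so that long numerals are costly. *)
Local Notation k := (10 ^+ 3).

Definition cA t : S := 3 * t + 1.
Definition cB t : S := 2 * t ^+ 2 + 3 * t + 3.
Definition cC t : S := 3 * t ^+ 2 + 2 * t + 2.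
Definition cD t : S := 5 * t ^+ 2 + 4 * t + 3.
Definition cE t : S :=
  3 * t ^+ 5 + 15 * t ^+ 4 + 15 * t ^+ 3 + 45 * t ^+ 2 + 40 * t + 26.
(** Factor of both resultants below. *)
Definition cU t : S := 3 * t ^+ 2 + 3 * t + 2.

Definition f2 t : S :=
  4941 * t ^+ 6 + 13122 * t ^+ 5 + 19905 * t ^+ 4 + 17820 * t ^+ 3
  + 10795 * t ^+ 2 + 3962 * t + 879.
Definition f1 t : S :=
  432 * t ^+ 5 + 570 * t ^+ 4 + 330 * t ^+ 3 - 265 * t ^+ 2 - 340 * t - 151.
Definition g1 t : S :=
  27 * t ^+ 10 + 270 * t ^+ 9 + 945 * t ^+ 8 + 2160 * t ^+ 7 + 2745 * t ^+ 6
  + 1926 * t ^+ 5 - 5 * t ^+ 4 - 1340 * t ^+ 3 - 1440 * t ^+ 2 - 720 * t - 216.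
Definition h1 t : S :=
  135 * t ^+ 6 + 396 * t ^+ 5 + 715 * t ^+ 4 + 790 * t ^+ 3 + 610 * t ^+ 2
  + 280 * t + 82.

(** The quintic P is the quotient of the left-hand side of [wronskian_identity]
by CD x - E; here are the nontrivial factors of its coefficients. *)
Definition p4 t : S :=
  (6 * k + 804) * t ^+ 8 + (22 * k + 734) * t ^+ 7 + (44 * k + 523) * t ^+ 6
    + (55 * k + 962) * t ^+ 5 + (50 * k + 820) * t ^+ 4
    + (32 * k + 678) * t ^+ 3 + (15 * k + 183) * t ^+ 2 + (4 * k + 506) * t
    + 774.
Definition p3 t : S :=
  (920 * k + 727) * t ^+ 14 + (5 * k ^+ 2 + 361 * k + 66) * t ^+ 13
    + (16 * k ^+ 2 + 821 * k + 918) * t ^+ 12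
    + (35 * k ^+ 2 + 527 * k + 914) * t ^+ 11
    + (55 * k ^+ 2 + 893 * k + 222) * t ^+ 10
    + (68 * k ^+ 2 + 760 * k + 18) * t ^+ 9
    + (68 * k ^+ 2 + 279 * k + 994) * t ^+ 8
    + (55 * k ^+ 2 + 733 * k + 262) * t ^+ 7
    + (37 * k ^+ 2 + 826 * k + 301) * t ^+ 6
    + (21 * k ^+ 2 + 378 * k + 648) * t ^+ 5
    + (9 * k ^+ 2 + 992 * k + 628) * t ^+ 4
    + (3 * k ^+ 2 + 770 * k + 224) * t ^+ 3
    + (k ^+ 2 + 100 * k + 102) * t ^+ 2 + (224 * k + 196) * t
    + (25 * k + 908).
Definition p2 t : S :=
  (83 * k + 106) * t ^+ 15 + (k ^+ 2 + 195 * k + 560) * t ^+ 14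
    + (6 * k ^+ 2 + 891 * k + 885) * t ^+ 13
    + (24 * k ^+ 2 + 448 * k + 635) * t ^+ 12
    + (60 * k ^+ 2 + 803 * k + 55) * t ^+ 11
    + (113 * k ^+ 2 + 516 * k + 721) * t ^+ 10
    + (165 * k ^+ 2 + 97 * k + 665) * t ^+ 9
    + (191 * k ^+ 2 + 305 * k + 215) * t ^+ 8
    + (178 * k ^+ 2 + 753 * k + 865) * t ^+ 7
    + (135 * k ^+ 2 + 369 * k + 245) * t ^+ 6
    + (82 * k ^+ 2 + 903 * k + 962) * t ^+ 5
    + (40 * k ^+ 2 + 666 * k + 90) * t ^+ 4
    + (15 * k ^+ 2 + 625 * k + 390) * t ^+ 3
    + (4 * k ^+ 2 + 512 * k + 690) * t ^+ 2 + (893 * k + 520) * t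
    + (98 * k + 388).
Definition p1 t : S :=
  (2 * k + 916) * t ^+ 10 + (11 * k + 745) * t ^+ 9 + (36 * k + 45) * t ^+ 8
    + (84 * k + 375) * t ^+ 7 + (148 * k + 905) * t ^+ 6
    + (192 * k + 339) * t ^+ 5 + (182 * k + 565) * t ^+ 4
    + (124 * k + 565) * t ^+ 3 + (60 * k + 375) * t ^+ 2 + (18 * k + 960) * t
    + (3 * k + 514).

(** Coefficients by increasing degree in x, cleared of denominators: these are
A^2 B F11, A^2 B G11, B H11 and A^3 B^2 times the quintic of the theorem. *)
Definition coefF t : seq S :=
  [:: 3 * cB t ^+ 2 * cA t ^+ 6; cA t ^+ 3 * f1 t; - f2 t; cA t ^+ 2 * cB t].
Definition coefG t : seq S :=
  [:: - (4 * cA t ^+ 3 * cB t ^+ 2); g1 t; cA t ^+ 2 * cB t * cC t ^+ 2].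
Definition coefH t : seq S := [:: cB t ^+ 2 * cA t ^+ 3; h1 t; cB t * cD t].
Definition coefP t : seq S :=
  [:: - (9 * cA t ^+ 9 * cB t ^+ 4 * cE t);
      - (5 * cA t ^+ 6 * cB t ^+ 2 * p1 t); - (5 * cA t ^+ 3 * p2 t);
      - (15 * cB t * p3 t); 5 * cA t ^+ 2 * cB t ^+ 2 * p4 t;
      cA t ^+ 4 * cB t ^+ 3 * cC t].
Definition Fpoly t : {poly S} := Poly (coefF t).
Definition Gpoly t : {poly S} := Poly (coefG t).
Definition Hpoly t : {poly S} := Poly (coefH t).
Definition Ppoly t : {poly S} := Poly (coefP t).

Local Ltac unfold_coefs :=
  rewrite /cA /cB /cC /cD /cE /cU /f2 /f1 /g1 /h1 /p4 /p3 /p2 /p1.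

Lemma complement_identity t :
  (108 * cA t ^+ 6)%:P * Hpoly t ^+ 5 + (cB t ^+ 2)%:P * (Fpoly t ^+ 3 * Gpoly t)
  = 'X * Ppoly t ^+ 2.
Proof.
rewrite /Fpoly /Gpoly /Hpoly /Ppoly /coefF /coefG /coefH /coefP /= !cons_poly_def.
unfold_coefs; ring.
Qed.

Lemma wronskian_identity t :
  let F := Fpoly t in let G := Gpoly t in let H := Hpoly t in
  3 * F^`() * G * H + F * G^`() * H - 5 * F * G * H^`()
  = Ppoly t * ((cC t * cD t)%:P * 'X - (cE t)%:P).
Proof.
rewrite /Fpoly /Gpoly /Hpoly /Ppoly /coefF /coefG /coefH /coefP /= !cons_poly_def.
(* differentiation comes first, while the coefficients are still folded *)
rewrite !derivE; unfold_coefs; ring.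
Qed.

(** The left-hand side is the resultant of the two quadratics.  With l x + m
the combination a2 b - b2 a, free of x^2, it lies in the ideal of a and b. *)
Lemma resultant_quadratic_quadratic (a2 a1 a0 b2 b1 b0 u : S) :
    a2 * u ^+ 2 + a1 * u + a0 = 0 -> b2 * u ^+ 2 + b1 * u + b0 = 0 ->
  (a2 * b0 - a0 * b2) ^+ 2 - (a2 * b1 - a1 * b2) * (a1 * b0 - a0 * b1) = 0.
Proof.
set a := _ + a0; set b := _ + b0 => a_0 b_0.
pose l := a2 * b1 - a1 * b2; pose m := a2 * b0 - a0 * b2.
have -> : m ^+ 2 - l * (a1 * b0 - a0 * b1)
        = (m - l * u) * (a2 * b - b2 * a) - l * (a1 * b - b1 * a).
  by rewrite /m /l /a /b; ring.
by rewrite a_0 b_0 !(mulr0, subr0).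
Qed.

(** The resultant of G and H is, up to sign, this product. *)
Lemma Gpoly_Hpoly_common_root t u : (Gpoly t).[u] = 0 -> (Hpoly t).[u] = 0 ->
  400 * cA t ^+ 3 * cB t ^+ 3 * (t + 2) ^+ 2 * (t ^+ 2 + 1) ^+ 4 * cU t ^+ 6 = 0.
Proof.
rewrite !horner_Poly /= !mul0r !add0r => Gu Hu.
have G0 : cA t ^+ 2 * cB t * cC t ^+ 2 * u ^+ 2 + g1 t * u
    + - (4 * cA t ^+ 3 * cB t ^+ 2) = 0 by rewrite -[RHS]Gu; ring.
have H0 : cB t * cD t * u ^+ 2 + h1 t * u + cB t ^+ 2 * cA t ^+ 3 = 0.
  by rewrite -[RHS]Hu; ring.
apply/eqP; rewrite -oppr_eq0 -(resultant_quadratic_quadratic H0 G0); apply/eqP.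
unfold_coefs; ring.
Qed.

(** Here l x + m is b2^2 times the remainder of the cubic by the quadratic, and
the conclusion is the resultant of that remainder with the quadratic. *)
Lemma resultant_cubic_quadratic (a3 a2 a1 a0 b2 b1 b0 u : S) :
    a3 * u ^+ 3 + a2 * u ^+ 2 + a1 * u + a0 = 0 -> b2 * u ^+ 2 + b1 * u + b0 = 0 ->
  let c := b2 * a2 - b1 * a3 in
  let l := b2 * (b2 * a1 - b0 * a3) - b1 * c in
  let m := b2 ^+ 2 * a0 - b0 * c in
  b2 * m ^+ 2 - b1 * l * m + b0 * l ^+ 2 = 0.
Proof.
set a := _ + a0; set b := _ + b0 => a_0 b_0 c l m.
have -> : b2 * m ^+ 2 - b1 * l * m + b0 * l ^+ 2 = l ^+ 2 * b
    + (b2 ^+ 2 * a - (b2 * a3 * u + c) * b) * (b2 * (m - l * u) - b1 * l).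
  by rewrite /m /l /c /a /b; ring.
by rewrite a_0 b_0 !(mulr0, subr0, mul0r, addr0).
Qed.

(** The product is, up to sign, the resultant of F and H times the square of BD,
the leading coefficient of H. *)
Lemma Fpoly_Hpoly_common_root t u : (Fpoly t).[u] = 0 -> (Hpoly t).[u] = 0 ->
  250 * k * cA t ^+ 6 * cB t ^+ 5 * cD t ^+ 2 * (t ^+ 2 + 1) ^+ 2 * cU t ^+ 8 = 0.
Proof.
rewrite !horner_Poly /= !mul0r !add0r => Fu Hu.
have F0 : cA t ^+ 2 * cB t * u ^+ 3 + - f2 t * u ^+ 2 + cA t ^+ 3 * f1 t * u
    + 3 * cB t ^+ 2 * cA t ^+ 6 = 0 by rewrite -[RHS]Fu; ring.
have H0 : cB t * cD t * u ^+ 2 + h1 t * u + cB t ^+ 2 * cA t ^+ 3 = 0.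
  by rewrite -[RHS]Hu; ring.
apply/eqP; rewrite -oppr_eq0 -(resultant_cubic_quadratic F0 H0); apply/eqP.
unfold_coefs; ring.
Qed.
End IntegralModel.

(** * The exceptional parameters *)

(** Value at (x, w) of the homogenization of the polynomial with coefficients s,
by increasing degree.  It clears the denominator of the value at x/w. *)
Fixpoint homval (S : comNzRingType) (s : seq S) (x w : S) : S :=
  if s is c :: s' then c * w ^+ size s' + x * homval s' x w else 0.

Lemma homval_horner (S : comNzRingType) (s : seq S) u w :
  homval s (u * w) w * w = w ^+ size s * (Poly s).[u].
Proof.
rewrite horner_Poly; elim: s => [|c s IHs] /=; first by rewrite mulr0 mul0r.
rewrite mulrDl -[u * w * _ * w]mulrA IHs exprS; ring.
Qed.

Lemma rmorph_homval (S S' : comNzRingType) (f : {rmorphism S -> S'}) s x w :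
  f (homval s x w) = homval (map f s) (f x) (f w).
Proof.
elim: s => [|c s IHs] /=; first by rewrite rmorph0.
by rewrite rmorphD !rmorphM rmorphXn size_map IHs.
Qed.

Definition value_at_extra (S : comNzRingType) (s : seq S) (t : S) : S :=
  homval s (cE t) (cC t * cD t).

Definition degeneracy (S : comNzRingType) (t : S) : S :=
  cA t * cB t * cC t * cD t * cE t * cU t * (t + 2) * (t ^+ 2 + 1)
  * value_at_extra (coefF t) t * value_at_extra (coefG t) t
  * value_at_extra (coefH t) t * value_at_extra (coefP t) t.

(** The family commutes with ring morphisms, so that [degeneracy] at a given t is
the value at t of one polynomial. *)
Section Morphism.
Variables (S S' : comNzRingType) (f : {rmorphism S -> S'}) (t : S).

Lemma rmorph_cA : f (cA t) = cA (f t). Proof. by rewrite /cA; ring. Qed.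
Lemma rmorph_cB : f (cB t) = cB (f t). Proof. by rewrite /cB; ring. Qed.
Lemma rmorph_cC : f (cC t) = cC (f t). Proof. by rewrite /cC; ring. Qed.
Lemma rmorph_cD : f (cD t) = cD (f t). Proof. by rewrite /cD; ring. Qed.
Lemma rmorph_cE : f (cE t) = cE (f t). Proof. by rewrite /cE; ring. Qed.
Lemma rmorph_cU : f (cU t) = cU (f t). Proof. by rewrite /cU; ring. Qed.
Lemma rmorph_f2 : f (f2 t) = f2 (f t). Proof. by rewrite /f2; ring. Qed.
Lemma rmorph_f1 : f (f1 t) = f1 (f t). Proof. by rewrite /f1; ring. Qed.
Lemma rmorph_g1 : f (g1 t) = g1 (f t). Proof. by rewrite /g1; ring. Qed.
Lemma rmorph_h1 : f (h1 t) = h1 (f t). Proof. by rewrite /h1; ring. Qed.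
Lemma rmorph_p4 : f (p4 t) = p4 (f t). Proof. by rewrite /p4; ring. Qed.
Lemma rmorph_p3 : f (p3 t) = p3 (f t). Proof. by rewrite /p3; ring. Qed.
Lemma rmorph_p2 : f (p2 t) = p2 (f t). Proof. by rewrite /p2; ring. Qed.
Lemma rmorph_p1 : f (p1 t) = p1 (f t). Proof. by rewrite /p1; ring. Qed.

Lemma map_coefs :
  [/\ map f (coefF t) = coefF (f t), map f (coefG t) = coefG (f t),
      map f (coefH t) = coefH (f t) & map f (coefP t) = coefP (f t)].
Proof.
rewrite /coefF /coefG /coefH /coefP -rmorph_cA -rmorph_cB -rmorph_cC -rmorph_cD
  -rmorph_cE -rmorph_f2 -rmorph_f1 -rmorph_g1 -rmorph_h1 -rmorph_p4 -rmorph_p3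
  -rmorph_p2 -rmorph_p1 !map_cons.
by split; do ?congr (_ :: _); ring.
Qed.

Lemma rmorph_degeneracy : f (degeneracy t) = degeneracy (f t).
Proof.
have [fF fG fH fP] := map_coefs.
rewrite /degeneracy /value_at_extra -fF -fG -fH -fP.
rewrite -rmorph_cA -rmorph_cB -rmorph_cC -rmorph_cD -rmorph_cE -rmorph_cU.
by rewrite -(rmorphM f (cC t)) -!rmorph_homval; ring.
Qed.
End Morphism.

Lemma degeneracy0 (S : comNzRingType) :
  degeneracy 0 = - (2 ^+ 46 * 3 ^+ 8 * 5 ^+ 12 * 7 * 13 ^+ 2 * 19) :> S.
Proof.
rewrite /degeneracy /value_at_extra /= /cA /cB /cC /cD /cE /cU.
by rewrite /f2 /f1 /g1 /h1 /p4 /p3 /p2 /p1; ring.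
Qed.

Lemma degeneracyX_neq0 (K : numDomainType) : degeneracy 'X != 0 :> {poly K}.
Proof.
apply/eqP => /(congr1 (horner_eval 0)).
rewrite rmorph_degeneracy /= /horner_eval hornerX horner0 degeneracy0.
by apply/eqP; rewrite oppr_eq0 !(mulf_eq0, expf_eq0) !pnatr_eq0.
Qed.

(** * The map as a quotient of integral polynomials *)

Section Family.
Variables (K : fieldType) (t : K).
Hypotheses (AN0 : cA t != 0) (BN0 : cB t != 0).

Lemma Fpoly_F11 : Fpoly t = (cA t ^+ 2 * cB t)%:P * F11 t.
Proof.
rewrite /F11 -[3 * t + 1]/(cA t) -[2 * t ^+ 2 + 3 * t + 3]/(cB t).
set a := _ / (_ * _); set b := _ * _ / _.
have -> : Fpoly t = Poly [:: 3 * cB t ^+ 2 * cA t ^+ 6; cA t ^+ 2 * cB t * b;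
                             - (cA t ^+ 2 * cB t * a); cA t ^+ 2 * cB t].
  by rewrite /Fpoly /coefF; congr (Poly [:: _; _; - _; _]);
    rewrite /a /b /f1 /f2; field; rewrite ?BN0.
by rewrite /= !cons_poly_def -!mul_polyC; ring.
Qed.

Lemma Gpoly_G11 : Gpoly t = (cA t ^+ 2 * cB t)%:P * G11 t.
Proof.
rewrite /G11 -[3 * t + 1]/(cA t) -[2 * t ^+ 2 + 3 * t + 3]/(cB t)
  -[3 * t ^+ 2 + 2 * t + 2]/(cC t).
set a := _ / (_ * _).
have -> : Gpoly t = Poly [:: - (4 * cA t ^+ 3 * cB t ^+ 2); cA t ^+ 2 * cB t * a;
                             cA t ^+ 2 * cB t * cC t ^+ 2].
  by rewrite /Gpoly /coefG; congr (Poly [:: _; _; _]); rewrite /a /g1; field; rewrite AN0.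
by rewrite /= !cons_poly_def -!mul_polyC; ring.
Qed.

Lemma Hpoly_H11 : Hpoly t = (cB t)%:P * H11 t.
Proof.
rewrite /H11 -[3 * t + 1]/(cA t) -[2 * t ^+ 2 + 3 * t + 3]/(cB t)
  -[5 * t ^+ 2 + 4 * t + 3]/(cD t).
set a := _ / _.
have -> : Hpoly t = Poly [:: cB t ^+ 2 * cA t ^+ 3; cB t * a; cB t * cD t].
  by rewrite /Hpoly /coefH; congr (Poly [:: _; _; _]); rewrite /a /h1; field.
by rewrite /= !cons_poly_def -!mul_polyC; ring.
Qed.

Definition phi_num : {poly K} := - ((cB t ^+ 2)%:P * (Fpoly t ^+ 3 * Gpoly t)).
Definition phi_den : {poly K} := (108 * cA t ^+ 6)%:P * Hpoly t ^+ 5.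

Hypothesis N108 : 108 != 0 :> K.

Lemma Hpoly_neq0 : Hpoly t != 0.
Proof.
apply/eqP => /(congr1 (fun p : {poly K} => p`_0)); rewrite coef_Poly coef0 /=.
by apply/eqP; rewrite mulf_neq0 ?expf_neq0.
Qed.

Lemma phi_den_neq0 : phi_den != 0.
Proof.
by rewrite mulf_neq0 ?expf_neq0 ?Hpoly_neq0 // polyC_eq0 mulf_neq0 ?expf_neq0.
Qed.

Lemma H11_neq0 : H11 t != 0.
Proof. by apply: contraNneq Hpoly_neq0 => H0; rewrite Hpoly_H11 H0 mulr0. Qed.

Lemma phi11E : phi11 t = phi_num%:F / phi_den%:F.
Proof.
rewrite /phi11 -[3 * t + 1]/(cA t) -[2 * t ^+ 2 + 3 * t + 3]/(cB t) /cst.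
rewrite mulrA -tofracN -tofracM; apply/eqP.
rewrite eqr_div ?tofrac_eq0 ?phi_den_neq0 ?expf_neq0 ?H11_neq0 // -!tofracM tofrac_eq.
rewrite /phi_num /phi_den Fpoly_F11 Gpoly_G11 Hpoly_H11.
apply/eqP; have coefE : cB t * cA t ^+ 2 / 108 * (108 * cA t ^+ 6) = cB t * cA t ^+ 8.
  by field.
transitivity ((cB t * cA t ^+ 2 / 108 * (108 * cA t ^+ 6))%:P
  * - (F11 t ^+ 3 * G11 t * ((cB t)%:P * H11 t) ^+ 5)).
  by rewrite polyCM; set c := _ %:P; set c' := (108 * _)%:P; ring.
rewrite coefE; ring.
Qed.

(** So that phi11 = 1 exactly at 0 and at the roots of P. *)
Lemma phi_num_den_complement : phi_den - phi_num = 'X * Ppoly t ^+ 2 :> {poly K}.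
Proof. by rewrite -complement_identity opprK. Qed.

Lemma complement_phi11 (P : {poly K}) : Ppoly t = (cA t ^+ 3 * cB t ^+ 2)%:P * P ->
  1 - phi11 t = cst (1 / (108 * cB t)) * (('X * P ^+ 2)%:F / (H11 t ^+ 5)%:F).
Proof.
move=> PE; have denN0 : phi_den%:F != 0 by rewrite tofrac_eq0 phi_den_neq0.
rewrite phi11E -(divff denN0) -mulrBl -tofracB phi_num_den_complement.
rewrite /cst [RHS]mulrA -tofracM.
apply/eqP; rewrite eqr_div ?tofrac_eq0 ?phi_den_neq0 ?expf_neq0 ?H11_neq0 //.
rewrite -!tofracM tofrac_eq; apply/eqP.
rewrite PE /phi_den Hpoly_H11.
have coefE : 1 / (108 * cB t) * (108 * cA t ^+ 6) * cB t  = cA t ^+ 6.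
  by field; exact/andP.
transitivity ((1 / (108 * cB t) * (108 * cA t ^+ 6) * cB t)%:P * (cB t ^+ 4)%:P
  * ('X * P ^+ 2 * H11 t ^+ 5)).
  by rewrite coefE; ring.
by rewrite !polyCM; set c := (_^-1)%:P; ring.
Qed.

End Family.

(** * Multiplicities of roots *)

Lemma lead_Poly (S : nzRingType) (s : seq S) : last 0 s != 0 ->
  size (Poly s) = size s /\ lead_coef (Poly s) = last 0 s.
Proof.
move=> sN0; have sE : Poly s = s :> seq S.
  by apply: (@PolyK _ 0); case: s sN0 => [|a s] //=.
by rewrite lead_coefE sE nth_last.
Qed.

Lemma mupX (K : fieldType) (p : {poly K}) u n :
  p != 0 -> mup u (p ^+ n) = (n * mup u p)%N.
Proof.
move=> pN0; elim: n => [|n IHn]; first by rewrite mupNroot // root1.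
by rewrite exprS mupM ?expf_neq0 // IHn mulSn.
Qed.

Lemma map_nseq_in (T : eqType) (U : Type) (g : T -> U) c (s : seq T) :
  {in s, forall x, g x = c} -> map g s = nseq (size s) c.
Proof.
elim: s => //= x s IHs gc; rewrite gc ?mem_head // IHs // => y ys.
by rewrite gc // inE ys orbT.
Qed.

Lemma root_mup (K : fieldType) (p : {poly K}) u : p != 0 -> root p u = (0 < mup u p)%N.
Proof. by move=> pN0; rewrite -dvdp_XsubCl XsubC_dvd. Qed.

(** * The generic member of the family *)

Section Geometry.
Variables (K : numClosedFieldType) (t : K).
Hypothesis tN0 : degeneracy t != 0.

Let F := Fpoly t.
Let G := Gpoly t.
Let H := Hpoly t.
Let P := Ppoly t.
Let n := phi_num t.
Let d := phi_den t.
Let e := extra11 t.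
Let phi := phi11 t.

Lemma nondegenerate :
  [/\ [/\ cA t != 0, cB t != 0, cC t != 0 & cD t != 0],
      [/\ cE t != 0, cU t != 0, t + 2 != 0 & t ^+ 2 + 1 != 0] &
      [/\ ~~ root F e, ~~ root G e, ~~ root H e & ~~ root P e]].
Proof.
move: tN0; rewrite /degeneracy; set v := @value_at_extra K.
rewrite !mulf_eq0 !negb_or -!andbA.
case/and5P=> AN0 BN0 CN0 DN0 /and5P[EN0 UN0 t2N0 t21N0 /and4P[FeN0 GeN0 HeN0 PeN0]].
have wN0 : cC t * cD t != 0 by rewrite mulf_neq0.
have eE : cE t = e * (cC t * cD t) by rewrite /e /extra11 divfK.
have ev s : v s t != 0 -> ~~ root (Poly s) e.
  rewrite /v /value_at_extra eE => sN0.
  have : homval s (e * (cC t * cD t)) (cC t * cD t) * (cC t * cD t) != 0.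
    by rewrite mulf_neq0.
  by rewrite homval_horner mulf_eq0 negb_or => /andP[].
by split; split=> //; apply: ev.
Qed.

Let AN0 : cA t != 0. Proof. by case: nondegenerate => -[]. Qed.
Let BN0 : cB t != 0. Proof. by case: nondegenerate => -[]. Qed.
Let CN0 : cC t != 0. Proof. by case: nondegenerate => -[]. Qed.
Let DN0 : cD t != 0. Proof. by case: nondegenerate => -[]. Qed.
Let N108 : 108 != 0 :> K. Proof. by rewrite pnatr_eq0. Qed.

Let char0 m : m.+1%:R != 0 :> K. Proof. by rewrite pnatr_eq0. Qed.
Let phiE : phi = n%:F / d%:F. Proof. exact: phi11E. Qed.
Let dN0 : d != 0. Proof. exact: phi_den_neq0. Qed.

Let FN0 : F != 0.
Proof.
by case: nondegenerate => _ _ [pe _ _ _]; apply: contraNneq pe => ->; rewrite root0.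
Qed.
Let GN0 : G != 0.
Proof.
by case: nondegenerate => _ _ [_ pe _ _]; apply: contraNneq pe => ->; rewrite root0.
Qed.
Let HN0 : H != 0.
Proof.
by case: nondegenerate => _ _ [_ _ pe _]; apply: contraNneq pe => ->; rewrite root0.
Qed.
Let PN0 : P != 0.
Proof.
by case: nondegenerate => _ _ [_ _ _ pe]; apply: contraNneq pe => ->; rewrite root0.
Qed.

Lemma size_FGHP : [/\ size F = 4%N, size G = 3%N, size H = 3%N & size P = 6%N].
Proof.
by split; apply: (proj1 (lead_Poly _)); rewrite /= !mulf_neq0 ?expf_neq0.
Qed.

Lemma root_num u : root n u = root F u || root G u.
Proof.
rewrite /n /phi_num /root hornerN oppr_eq0 hornerM hornerC hornerM horner_exp.
by rewrite !(expf_eq0, mulf_eq0) /= (negPf BN0).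
Qed.

Lemma root_den u : root d u = root H u.
Proof.
rewrite /d /phi_den /root hornerM hornerC horner_exp.
by rewrite !(expf_eq0, mulf_eq0) /= (negPf AN0) pnatr_eq0.
Qed.

Lemma root_num_not_H u : root n u -> ~~ root H u.
Proof.
have [_ [_ UN0 t2 t21] _] := nondegenerate.
rewrite root_num; apply: contraL => /eqP Hu; rewrite negb_or; apply/andP; split.
  apply/eqP => Fu; have /eqP := Fpoly_Hpoly_common_root Fu Hu.
  by apply/negP; rewrite !mulf_neq0 ?expf_neq0 ?pnatr_eq0.
apply/eqP => Gu; have /eqP := Gpoly_Hpoly_common_root Gu Hu.
by apply/negP; rewrite !mulf_neq0 ?expf_neq0 ?pnatr_eq0.
Qed.

Lemma coprime_num_den : coprimep n d.
Proof.
apply/Pdiv.ClosedField.root_coprimep => u nu; apply: contra (root_num_not_H nu).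
by rewrite -root_den.
Qed.

Lemma wronskianE :
  n^`() * d - n * d^`()
  = (- (108 * cA t ^+ 6 * cB t ^+ 2 * (cC t * cD t)))
    *: (F ^+ 2 * H ^+ 4 * P * ('X - e%:P)).
Proof.
have lin : (cC t * cD t)%:P * ('X - e%:P) = (cC t * cD t)%:P * 'X - (cE t)%:P :> {poly K}.
  by rewrite mulrBr -polyCM /e /extra11 mulrC [_ * (_ / _)]mulrC divfK // mulf_neq0.
have := wronskian_identity t; rewrite -lin -/F -/G -/H -/P => /= wr.
transitivity (- (108 * cA t ^+ 6 * cB t ^+ 2)%:P * F ^+ 2 * H ^+ 4
   * (3 * F^`() * G * H + F * G^`() * H - 5 * F * G * H^`())).
  rewrite /n /d /phi_num /phi_den -/F -/G -/H.
  by rewrite !(derivN, derivC, deriv_exp, derivM) /=; ring.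
by rewrite wr -mul_polyC; ring.
Qed.

Let W := n^`() * d - n * d^`().
Let WN0 : W != 0.
Proof.
rewrite /W wronskianE scaler_eq0 negb_or oppr_eq0.
by rewrite !mulf_neq0 ?expf_neq0 ?polyXsubC_eq0 ?pnatr_eq0.
Qed.

Lemma mup_W u :
  mup u W = (2 * mup u F + 4 * mup u H + mup u P + (u == e))%N.
Proof.
rewrite /W wronskianE mupZ; last first.
  by rewrite oppr_eq0 !mulf_neq0 ?expf_neq0 ?pnatr_eq0.
rewrite 3?mupM ?mulf_neq0 ?expf_neq0 ?polyXsubC_eq0 // !mupX //.
by rewrite -['X - _]expr1 mup_XsubCX eq_sym; case: eqP.
Qed.

Lemma ramord_finite u :
  ramord phi (Some u) = (2 * mup u F + 4 * mup u H + mup u P + (u == e)).+1.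
Proof. by rewrite phiE (ramord_wronskian char0) ?coprime_num_den // -mup_W. Qed.

Lemma rmap_finite u :
  rmap phi (Some u) = if root H u then None else Some (n.[u] / d.[u]).
Proof.
by rewrite phiE rmap_reduced ?coprime_num_den // -[_ == 0]/(root d u) root_den.
Qed.

Lemma rmap_eq_infty u : (rmap phi (Some u) == None) = root H u.
Proof. by rewrite rmap_finite; case: ifP. Qed.

Lemma rmap_eq0 u : (rmap phi (Some u) == Some 0) = root F u || root G u.
Proof.
rewrite rmap_finite -root_num; case: ifPn => [Hu|]; last first.
  rewrite -root_den => du; rewrite -[LHS]/(n.[u] / d.[u] == 0) mulf_eq0 invr_eq0.
  by rewrite [d.[u] == 0](negPf du) orbF.
by symmetry; apply/negbTE; apply: contraL Hu => /root_num_not_H.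
Qed.

Lemma rmap_eq1 u : (rmap phi (Some u) == Some 1) = (u == 0) || root P u.
Proof.
have rootXP : ((u == 0) || root P u) = (d.[u] == n.[u]).
  rewrite -(subr_eq0 d.[u]) -hornerN -hornerD [d - n]phi_num_den_complement.
  by rewrite hornerM hornerX horner_exp mulf_eq0 expf_eq0.
rewrite rootXP rmap_finite; case: ifPn => [Hu|].
  symmetry; apply/negbTE; apply: contraL Hu => /eqP dn; rewrite -root_den /root.
  apply/negP=> d0; have : root n u by rewrite /root -dn.
  by move/root_num_not_H; rewrite -root_den /root d0.
rewrite -root_den => du; rewrite -[LHS]/(n.[u] / d.[u] == 1) eq_sym.
by rewrite -(inj_eq (mulIf du)) mul1r divfK.
Qed.

Let e_regular : [/\ mup e F = 0, mup e G = 0, mup e H = 0 & mup e P = 0]%N.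
Proof. by case: nondegenerate => _ _ [*]; split; apply: mupNroot. Qed.

(** The multiplicity 3f + g of u in n is one more than its multiplicity 2f in
the Wronskian, so f + g = 1. *)
Lemma mult_over0 u : root F u || root G u ->
  (mup u F + mup u G = 1)%N /\ ramord phi (Some u) = (2 * mup u F).+1.
Proof.
move=> FGu; have nu : root n u by rewrite root_num.
have Hu := root_num_not_H nu.
have Pu : ~~ root P u.
  apply/negP=> Pu; have /eqP : rmap phi (Some u) == Some 0 by rewrite rmap_eq0.
  have /eqP-> : rmap phi (Some u) == Some 1 by rewrite rmap_eq1 Pu orbT.
  by case=> /eqP; rewrite oner_eq0.
have ue : (u == e) = false.
  apply: contraTF FGu => /eqP->; have [Fe Ge _ _] := e_regular.
  by rewrite !root_mup // Fe Ge.
rewrite ramord_finite (mupNroot Hu) (mupNroot Pu) ue muln0 !addn0; split=> //.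
have := mup_wronskian char0 nu _ WN0; rewrite root_den => /(_ Hu).
rewrite -/W mup_W (mupNroot Hu) (mupNroot Pu) ue muln0 !addn0.
rewrite /n /phi_num -/F -/G -mulNr -polyCN mul_polyC mupZ ?oppr_eq0 ?expf_neq0 //.
rewrite mupM ?expf_neq0 // mupX //; move: (mup u F) (mup u G); clear; lia.
Qed.

(** The multiplicity [u = 0] + 2p of u in n - d is one more than its
multiplicity p in the Wronskian, so [u = 0] + p = 1. *)
Lemma mult_over1 u : (u == 0) || root P u ->
  ((u == 0%R) + mup u P = 1)%N /\ ramord phi (Some u) = (mup u P).+1.
Proof.
move=> Pu; have /eqP r1 : rmap phi (Some u) == Some 1 by rewrite rmap_eq1.
have Hu : ~~ root H u by rewrite -rmap_eq_infty r1.
have : ~~ (root F u || root G u).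
  by rewrite -rmap_eq0 r1; apply/eqP => -[/eqP]; rewrite oner_eq0.
rewrite negb_or => /andP[Fu Gu].
have ue : (u == e) = false.
  apply: contraTF Pu => /eqP->; have [_ _ _ Pe] := e_regular.
  rewrite root_mup // Pe orbF.
  have [_ [EN0 _ _ _] _] := nondegenerate.
  by rewrite /e /extra11 mulf_neq0 ?invr_eq0 ?mulf_neq0.
rewrite ramord_finite (mupNroot Hu) (mupNroot Fu) ue !muln0 !addn0 !add0n; split=> //.
have := @mup_wronskian _ char0 (n - 1 *: d) d u; rewrite wronskian_shift.
rewrite root_den -/W mup_W (mupNroot Hu) (mupNroot Fu) ue !muln0 !addn0 !add0n.
have -> : n - 1 *: d = - 1 *: ('X * P ^+ 2).
  by rewrite -[_ * _]phi_num_den_complement scale1r scaleN1r opprB.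
rewrite mupZ ?oppr_eq0 ?oner_eq0 // mupM ?polyX_eq0 ?expf_neq0 // mupX //.
have -> : mup u 'X = (u == 0) :> nat.
  by rewrite -['X]subr0 -[_ - 0]expr1 mup_XsubCX eq_sym; case: eqP.
have rXP : root (-1 *: ('X * P ^+ 2)) u.
  by rewrite /root hornerZ hornerM hornerX horner_exp !(expf_eq0, mulf_eq0) Pu orbT.
move=> /(_ rXP Hu WN0); case: eqP => _; move: (mup u P); clear; lia.
Qed.

(** The multiplicity 5h of u in d is one more than its multiplicity 4h in the
Wronskian, so h = 1. *)
Lemma mult_over_infty u : root H u -> mup u H = 1%N /\ ramord phi (Some u) = 5%N.
Proof.
move=> Hu; have /eqP rinf : rmap phi (Some u) == None by rewrite rmap_eq_infty.
have : ~~ (root F u || root G u) by rewrite -rmap_eq0 rinf.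
rewrite negb_or => /andP[Fu _].
have Pu : ~~ root P u.
  have : ~~ ((u == 0) || root P u) by rewrite -rmap_eq1 rinf.
  by rewrite negb_or => /andP[].
have ue : (u == e) = false.
  by apply: contraTF Hu => /eqP->; have [_ _ He _] := e_regular; rewrite root_mup // He.
have ramE := ramord_finite u.
have : ramord phi (Some u) = mup u d.
  by rewrite phiE ramord_reduced_pole ?coprime_num_den // root_den.
move: ramE; rewrite (mupNroot Fu) (mupNroot Pu) ue !muln0 !addn0 !add0n.
rewrite /d /phi_den -/H mul_polyC mupZ ?mulf_neq0 ?expf_neq0 // mupX //.
move: (mup u H) (ramord _ _); clear; lia.
Qed.

Lemma ramord_extra : ramord phi (Some e) = 2%N.
Proof. by rewrite ramord_finite eqxx; have [-> _ -> ->] := e_regular. Qed.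

Lemma size_num_den : size n = 12%N /\ size d = 11%N.
Proof.
have [sF sG sH _] := size_FGHP.
have size_X (p : {poly K}) m : p != 0 -> size (p ^+ m) = ((size p).-1 * m).+1.
  by move=> pN0; rewrite -size_exp prednK // size_poly_gt0 expf_neq0.
split.
  rewrite size_polyN mul_polyC size_scale ?expf_neq0 // size_mul ?expf_neq0 //.
  by rewrite size_X // sF sG.
by rewrite /d /phi_den mul_polyC size_scale ?mulf_neq0 ?expf_neq0 // size_X // sH.
Qed.

Lemma rmap_infty : rmap phi None = None.
Proof.
by rewrite phiE rmap_reduced_infty ?coprime_num_den //; have [-> ->] := size_num_den.
Qed.

Lemma ramord_infty : ramord phi None = 1%N.
Proof.
by rewrite phiE ramord_reduced_infty ?coprime_num_den //; have [-> ->] := size_num_den.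
Qed.

Lemma rdeg_phi : rdeg phi = 11%N.
Proof.
by rewrite phiE rdeg_reduced ?coprime_num_den //; have [-> ->] := size_num_den.
Qed.

Lemma fiber0 : fiber_pattern phi (Some 0) [:: 3; 3; 3; 1; 1]%N.
Proof.
have [sF sG _ _] := size_FGHP.
have Fmult u : root F u -> mup u F = 1%N /\ mup u G = 0%N.
  move=> Fu; have [] := @mult_over0 u; first by rewrite Fu.
  by move: Fu; rewrite root_mup //; move: (mup u F) (mup u G) (ramord _ _); clear; lia.
have Gmult u : root G u -> mup u G = 1%N /\ mup u F = 0%N.
  move=> Fu; have [] := @mult_over0 u; first by rewrite Fu orbT.
  by move: Fu; rewrite root_mup //; move: (mup u F) (mup u G) (ramord _ _); clear; lia.
have [rF [uF zF inF]] := simple_roots FN0 (fun u Fu => proj1 (Fmult u Fu)).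
have [rG [uG zG inG]] := simple_roots GN0 (fun u Gu => proj1 (Gmult u Gu)).
exists (map Some rF ++ map Some rG); split.
- rewrite -map_cat map_inj_uniq; last by move=> ? ? [].
  rewrite cat_uniq uF uG andbT; apply/hasPn => u; rewrite inG inF => Gu.
  by apply/negP => Fu; move: Gu; rewrite root_mup // (Fmult _ Fu).2.
- case=> [u|]; last by rewrite rmap_infty -map_cat; split=> // /mapP[].
  rewrite -map_cat mem_map; last by move=> ? ? [].
  rewrite mem_cat inF inG -rmap_eq0.
  by split=> /eqP.
rewrite map_cat -!map_comp (@map_nseq_in _ _ _ 3%N) ?(@map_nseq_in _ _ _ 1%N).
- by rewrite zF zG sF sG.
- move=> u; rewrite inG => Gu /=; have [|_ ->] := @mult_over0 u; first by rewrite Gu orbT.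
  by rewrite (Gmult _ Gu).2.
move=> u; rewrite inF => Fu /=; have [|_ ->] := @mult_over0 u; first by rewrite Fu.
by rewrite (Fmult _ Fu).1.
Qed.

Lemma fiber1 : fiber_pattern phi (Some 1) [:: 2; 2; 2; 2; 2; 1]%N.
Proof.
have [_ _ _ sP] := size_FGHP.
have Pmult u : root P u -> mup u P = 1%N /\ u != 0.
  move=> Pu; have [] := @mult_over1 u; first by rewrite Pu orbT.
  move: Pu; rewrite root_mup //; move: (u == 0) (mup u P) (ramord _ _); clear.
  by case; lia.
have [rP [uP zP inP]] := simple_roots PN0 (fun u Pu => proj1 (Pmult u Pu)).
have P0 : ~~ root P 0 by apply/negP => /Pmult[_]; rewrite eqxx.
exists (rcons (map Some rP) (Some 0)); split.
- rewrite rcons_uniq map_inj_uniq ?uP ?andbT; last by move=> ? ? [].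
  by rewrite mem_map ?inP // => ? ? [].
- case=> [u|]; last first.
    by rewrite rmap_infty mem_rcons inE /=; split=> // /mapP[].
  rewrite mem_rcons inE mem_map; last by move=> ? ? [].
  rewrite inP -[Some u == Some 0]/(u == 0) -rmap_eq1.
  by split=> /eqP.
rewrite map_rcons -map_comp (@map_nseq_in _ _ _ 2%N).
  rewrite zP sP; have [|_ ->] := @mult_over1 0; first by rewrite eqxx.
  by rewrite (mupNroot P0).
move=> u; rewrite inP => Pu /=; have [|_ ->] := @mult_over1 u; first by rewrite Pu orbT.
by rewrite (Pmult _ Pu).1.
Qed.

Lemma fiber_infty : fiber_pattern phi None [:: 5; 5; 1]%N.
Proof.
have [_ _ sH _] := size_FGHP.
have [rH [uH zH inH]] := simple_roots HN0 (fun u Hu => proj1 (mult_over_infty Hu)).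
exists (rcons (map Some rH) None); split.
- rewrite rcons_uniq map_inj_uniq ?uH ?andbT; last by move=> ? ? [].
  by apply/mapP => -[].
- case=> [u|]; last by rewrite rmap_infty mem_rcons inE eqxx.
  rewrite mem_rcons inE /= mem_map; last by move=> ? ? [].
  rewrite inH -rmap_eq_infty.
  by split=> /eqP.
rewrite map_rcons -map_comp (@map_nseq_in _ _ _ 5%N) ?ramord_infty.
  by rewrite zH sH.
by move=> u; rewrite inH => /mult_over_infty[].
Qed.

(** A finite ramified point is a root of the Wronskian: other than e, it is a
root of F, H or P, and lies above 0, infinity or 1. *)
Lemma extra_ram_point_phi : extra_ram_point phi (Some e).
Proof.
have [Fe Ge He Pe] := e_regular; have [_ [EN0 _ _ _] _] := nondegenerate.
split; first exact: ramord_extra.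
  rewrite !inE !negb_or rmap_eq0 rmap_eq1 rmap_eq_infty !root_mup // Fe Ge He Pe.
  by rewrite ltnn !orbF andbT /= /e /extra11 mulf_neq0 ?invr_eq0 ?mulf_neq0.
case=> [u|]; last by rewrite /ramified ramord_infty.
rewrite /ramified ramord_finite => ram ue.
rewrite !inE rmap_eq0 rmap_eq1 rmap_eq_infty !root_mup //.
have {ue} : u != e by apply: contra_not_neq ue => ->.
move: ram; move: (u == 0) (u == e) (mup u F) (mup u G) (mup u H) (mup u P); clear; lia.
Qed.

Lemma generic_covering :
  [/\ R4_pattern 11 [:: 3; 3; 3; 1; 1]%N [:: 2; 2; 2; 2; 2; 1]%N [:: 5; 5; 1]%N phi,
      forall x : P1 K, (rmap phi x = None /\ ~ ramified phi x) <-> x = None,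
      forall x : P1 K, (rmap phi x = Some 1 /\ ~ ramified phi x) <-> x = Some 0 &
      extra_ram_point phi (Some e)].
Proof.
split; last exact: extra_ram_point_phi.
- split=> //; last by split; [exact: fiber0|exact: fiber1|exact: fiber_infty].
    split; first by rewrite rdeg_phi.
    by exists (Some e); apply: extra_ram_point_phi.
  exact: rdeg_phi.
- case=> [u|]; last by rewrite rmap_infty /ramified ramord_infty.
  split=> // -[/eqP]; rewrite rmap_eq_infty => /mult_over_infty[_].
  by rewrite /ramified => ->.
case=> [u|]; last by rewrite rmap_infty; split=> // -[].
split=> [[/eqP]|[->]].
  rewrite rmap_eq1 => /mult_over1[]; rewrite /ramified => m ->.
  by case: eqP m => [->//|_]; rewrite add0n => ->.
have [|m rE] := @mult_over1 0; first by rewrite eqxx.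
split; first by apply/eqP; rewrite rmap_eq1 eqxx.
by rewrite /ramified rE; move: m; rewrite eqxx; case: mup.
Qed.

End Geometry.

(** * The theorem *)

Lemma complement_square (K : fieldType) (t : K) :
    cA t != 0 -> cB t != 0 -> cC t != 0 -> 108 != 0 :> K ->
  exists P : {poly K},
    [/\ size P = 6%N,
        lead_coef P = (3 * t ^+ 2 + 2 * t + 2) * (2 * t ^+ 2 + 3 * t + 3) * (3 * t + 1) &
        1 - phi11 t = cst (1 / (108 * (2 * t ^+ 2 + 3 * t + 3)))
                      * (('X * P ^+ 2)%:F / (H11 t ^+ 5)%:F)].
Proof.
move=> AN0 BN0 CN0 N108.
have [sP lP] : size (Ppoly t) = 6%N /\ lead_coef (Ppoly t) = cA t ^+ 4 * cB t ^+ 3 * cC t.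
  by apply: lead_Poly; rewrite !mulf_neq0 ?expf_neq0.
have cN0 : cA t ^+ 3 * cB t ^+ 2 != 0 by rewrite mulf_neq0 ?expf_neq0.
exists ((cA t ^+ 3 * cB t ^+ 2)^-1 *: Ppoly t); split.
- by rewrite size_scale // invr_eq0.
- rewrite lead_coefZ lP -[3 * t + 1]/(cA t) -[2 * t ^+ 2 + 3 * t + 3]/(cB t)
    -[3 * t ^+ 2 + 2 * t + 2]/(cC t).
  by field; rewrite AN0 BN0.
by apply: complement_phi11 => //; rewrite -mul_polyC mulrA -polyCM divff ?mul1r.
Qed.

Lemma degeneracy_tQ : degeneracy tQ != 0.
Proof. by rewrite -rmorph_degeneracy tofrac_eq0 degeneracyX_neq0. Qed.

Theorem mainTheorem2 (R : realType) :
  (exists P : {poly Qt},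
    [/\ size P = 6%N,
        lead_coef P = (3 * tQ ^+ 2 + 2 * tQ + 2)
                      * (2 * tQ ^+ 2 + 3 * tQ + 3) * (3 * tQ + 1) &
        1 - phi11 tQ = cst (1 / (108 * (2 * tQ ^+ 2 + 3 * tQ + 3)))
                       * (('X * P ^+ 2)%:F / (H11 tQ ^+ 5)%:F)])
  /\ (exists bad : seq R[i], forall t : R[i], t \notin bad ->
       [/\ R4_pattern 11 [:: 3; 3; 3; 1; 1]%N [:: 2; 2; 2; 2; 2; 1]%N
             [:: 5; 5; 1]%N (phi11 t),
           forall x : P1 R[i],
             (rmap (phi11 t) x = None /\ ~ ramified (phi11 t) x) <-> x = None,
           forall x : P1 R[i],
             (rmap (phi11 t) x = Some 1 /\ ~ ramified (phi11 t) x)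
             <-> x = Some 0 &
           extra_ram_point (phi11 t) (Some (extra11 t))]).
Proof.
split; last first.
  have [bad badE] := closed_field_poly_normal (degeneracy 'X : {poly R[i]}).
  exists bad => t t_bad; apply: generic_covering.
  have -> : degeneracy t = (degeneracy 'X).[t].
    by rewrite -/(horner_eval t _) rmorph_degeneracy /= /horner_eval hornerX.
  rewrite badE hornerZ mulf_neq0 ?lead_coef_eq0 ?degeneracyX_neq0 //.
  by rewrite -[_ == 0]/(root _ t) root_prod_XsubC.
have := degeneracy_tQ; rewrite /degeneracy !mulf_eq0 !negb_or -!andbA.
case/and4P=> AN0 BN0 CN0 _.
have N108 : 108 != 0 :> Qt.
  have -> : 108 = (108%:P)%:F :> Qt by rewrite polyC_natr !rmorph_nat.
  by rewrite tofrac_eq0 polyC_eq0.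
have [P [sP lP cP]] := complement_square AN0 BN0 CN0 N108.
by exists P; split; [exact: sP|exact: lP|exact: cP].
Qed.
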